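(* Let $(R,\mathfrak m,k)$ be a local Noetherian ring with $3\le v(R)$. If $T$ is a finitely generated $R$-module with $\mathfrak m^2T=0$, then $T$ is a proj-test module for $R$.
   Context: For a (commutative Noetherian) local ring $(R,\mathfrak m,k)$ with maximal ideal $\mathfrak m$, residue field $k=R/\mathfrak m$, and embedding dimension $n=\dim_k(\mathfrak m/\mathfrak m^2)$, $$v(R)=\inf\Big\{i\ \Big|\ \dim_k(\mathfrak m^i/\mathfrak m^{i+1})<\tbinom{(n-1)+i}{i}\Big\}.$$ Let $R$ be a commutative Noetherian ring and $T$ a finitely generated $R$-module. $T$ is a proj-test module for $R$ if the only finitely generated $R$-modules $N$ with $\operatorname{Tor}_i^R(T,N)=0$ for all positive $i$ are the projective $R$-modules.
   Formalization: The module T is additionally assumed to be nonzero; for T = 0 the claim fails, e.g. over R = k[[x]] (where v(R) is infinite) every Tor_i(0,N) vanishes but N = k is not projective. *)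

(* Defs.v *)
From HB Require Import structures.
From mathcomp Require Import all_boot all_algebra.
From mathcomp Require Import boolp classical_sets.

Set Implicit Arguments.
Unset Strict Implicit.
Unset Printing Implicit Defensive.

Import GRing.Theory.
Local Open Scope classical_set_scope.
Local Open Scope ring_scope.
Local Open Scope quotient_scope.

Section Ideals.
Variable R : comNzRingType.
Implicit Types I J m : set R.

Definition is_ideal I :=
  [/\ I 0, forall x y, I x -> I y -> I (x + y) & forall a x, I x -> I (a * x)].

Definition noetherian :=
  forall I, is_ideal I ->
  exists (n : nat) (a : 'I_n -> R),
    I = [set x | exists c : 'I_n -> R, x = \sum_i c i * a i].

Definition maximal_ideal m :=
  [/\ is_ideal m, ~ m 1 &
      forall J, is_ideal J -> ~ J 1 -> m `<=` J -> J = m].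

Definition local_ring m :=
  maximal_ideal m /\ forall J, maximal_ideal J -> J = m.

Definition ideal_mul I J : set R :=
  [set x | exists (n : nat) (a b : 'I_n -> R),
     [/\ forall i, I (a i), forall i, J (b i) & x = \sum_i a i * b i]].

Fixpoint ideal_pow I (n : nat) : set R :=
  if n is n'.+1 then ideal_mul I (ideal_pow I n') else setT.

(* For ideals [B `<=` A] with [m A `<=` B], the classes of [a 0, .., a (d-1)]
   form a basis of [A / B] over [k = R / m].  Scalars of [k] are represented
   by elements of [R], a scalar being zero when its representative is in [m],
   and a vector being zero when its representative is in [B]. *)
Definition residue_basis m (A B : set R) (d : nat) (a : 'I_d -> R) :=
  [/\ forall i, A (a i),
      forall x, A x -> exists c : 'I_d -> R, B (x - \sum_i c i * a i) &
      forall c : 'I_d -> R, B (\sum_i c i * a i) -> forall i, m (c i)].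

(* The default value 0 is taken only if [A / B] is infinite dimensional, which
   does not occur for powers of [m] in a Noetherian ring. *)
Definition residue_dim m (A B : set R) : nat :=
  xget 0%N [set d | exists a : 'I_d -> R, residue_basis m A B a].

Definition hilbert m (i : nat) : nat :=
  residue_dim m (ideal_pow m i) (ideal_pow m i.+1).

Definition embdim m : nat := residue_dim m m (ideal_pow m 2).

(* Infimum in the extended natural numbers, [None] standing for infinity. *)
Definition inf_nat (P : set nat) : option nat :=
  match pselect (exists n, `[< P n >]) with
  | left exP => Some (ex_minn exP)
  | right _ => None
  end.

Definition le_nat_inf (n : nat) (v : option nat) : Prop :=
  if v is Some i then (n <= i)%N else True.

(* The predecessor is taken after adding [i]: when the embedding dimension is
   0, truncating [n - 1] first would give 'C(i, i) = 1 instead of 0 for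
   [i > 0]. *)
Definition v_inv m : option nat :=
  inf_nat [set i | (hilbert m i < 'C((embdim m + i).-1, i))%N].

End Ideals.

Section Modules.
Variable R : comNzRingType.

Definition fin_gen (M : lmodType R) :=
  exists (n : nat) (x : 'I_n -> M),
    forall y, exists c : 'I_n -> R, y = \sum_i c i *: x i.

Definition projective (P : lmodType R) :=
  forall (A B : lmodType R) (g : {linear A -> B}) (f : {linear P -> B}),
    (forall b, exists a, g a = b) ->
    exists h : {linear P -> A}, forall x, g (h x) = f x.

End Modules.

(* A list [:: (x1, y1); ..; (xn, yn)] stands for the finite sum of the
   [xi (x) yi].  The tensor product is the quotient of these lists, an additive
   monoid under concatenation, by the least congruence containing the relations
   below; scalars and signs are absorbed in the left factors. *)
Section Tensor.
Variables (R : comNzRingType) (M N : lmodType R).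

Inductive tens_rel : seq (M * N) -> seq (M * N) -> Prop :=
| TensRefl s : tens_rel s s
| TensSym s t : tens_rel s t -> tens_rel t s
| TensTrans s t u : tens_rel s t -> tens_rel t u -> tens_rel s u
| TensCat s s' t t' :
    tens_rel s s' -> tens_rel t t' -> tens_rel (s ++ t) (s' ++ t')
| TensComm s t : tens_rel (s ++ t) (t ++ s)
| TensZero y : tens_rel [:: (0, y)] [::]
| TensAddl x x' y : tens_rel [:: (x + x', y)] [:: (x, y); (x', y)]
| TensAddr x y y' : tens_rel [:: (x, y + y')] [:: (x, y); (x, y')]
| TensScale a x y : tens_rel [:: (a *: x, y)] [:: (x, a *: y)].

Definition tens_eq : rel (seq (M * N)) := fun s t => `[< tens_rel s t >].

Lemma tens_eq_refl : reflexive tens_eq.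
Proof. by move=> s; apply/asboolP; exact: TensRefl. Qed.

Lemma tens_eq_sym : symmetric tens_eq.
Proof. by move=> s t; apply/asboolP/asboolP; exact: TensSym. Qed.

Lemma tens_eq_trans : transitive tens_eq.
Proof. by move=> t s u /asboolP st /asboolP tu; apply/asboolP/(TensTrans st). Qed.

Canonical tens_equiv := EquivRel tens_eq tens_eq_refl tens_eq_sym tens_eq_trans.

Definition tensor := {eq_quot tens_equiv}.
HB.instance Definition _ := Choice.on tensor.
HB.instance Definition _ := EqQuotient.on tensor.

Definition tens_cls (s : seq (M * N)) : tensor := \pi_tensor s.

Lemma tens_clsP s t : tens_cls s = tens_cls t <-> tens_rel s t.
Proof.
rewrite /tens_cls; split=> [/eqquotP /asboolP //|st].
by apply/eqquotP/asboolP.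
Qed.

Lemma tens_clsK u : tens_cls (repr u) = u.
Proof. exact: reprK. Qed.

Lemma tens_rel_repr s : tens_rel (repr (tens_cls s)) s.
Proof. by apply/tens_clsP; rewrite tens_clsK. Qed.

Definition tens_scale_seq (a : R) (s : seq (M * N)) :=
  [seq (a *: p.1, p.2) | p <- s].

Lemma tens_rel_scale a s t :
  tens_rel s t -> tens_rel (tens_scale_seq a s) (tens_scale_seq a t).
Proof.
elim=> {s t} [s|s t _|s t u _ st _|s s' t t' _ IH1 _ IH2|s t|y|x x' y|x y y'|b x y].
- exact: TensRefl.
- exact: TensSym.
- exact: TensTrans st.
- by rewrite /tens_scale_seq !map_cat; exact: TensCat.
- by rewrite /tens_scale_seq !map_cat; exact: TensComm.
- by rewrite /= scaler0; exact: TensZero.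
- by rewrite /= scalerDr; exact: TensAddl.
- exact: TensAddr.
- by rewrite /= scalerA mulrC -scalerA; exact: TensScale.
Qed.

Definition tens_zero : tensor := tens_cls [::].
Definition tens_add (u v : tensor) : tensor := tens_cls (repr u ++ repr v).
Definition tens_smul (a : R) (u : tensor) : tensor :=
  tens_cls (tens_scale_seq a (repr u)).
Definition tens_opp (u : tensor) : tensor := tens_smul (-1) u.

Lemma tens_addE s t : tens_add (tens_cls s) (tens_cls t) = tens_cls (s ++ t).
Proof. by apply/tens_clsP/TensCat; exact: tens_rel_repr. Qed.

Lemma tens_smulE a s : tens_smul a (tens_cls s) = tens_cls (tens_scale_seq a s).
Proof. by apply/tens_clsP/tens_rel_scale/tens_rel_repr. Qed.

Lemma tens_addA : associative tens_add.
Proof.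
move=> u v w; rewrite -[u]tens_clsK -[v]tens_clsK -[w]tens_clsK.
by rewrite !tens_addE catA.
Qed.

Lemma tens_addC : commutative tens_add.
Proof. by move=> u v; apply/tens_clsP/TensComm. Qed.

Lemma tens_add0 : left_id tens_zero tens_add.
Proof. by move=> u; rewrite -[u]tens_clsK tens_addE. Qed.

Lemma tens_smul0 u : tens_smul 0 u = tens_zero.
Proof.
apply/tens_clsP; elim: (repr u) => [|[x y] s IH]; first exact: TensRefl.
by rewrite /= scale0r; apply: (TensCat (TensZero y) IH).
Qed.

Lemma tens_smulA a b u : tens_smul a (tens_smul b u) = tens_smul (a * b) u.
Proof.
rewrite -[u]tens_clsK !tens_smulE /tens_scale_seq -map_comp.
by congr tens_cls; apply: eq_map => -[x y] /=; rewrite scalerA.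
Qed.

Lemma tens_smul1 : left_id 1 tens_smul.
Proof.
move=> u; rewrite -[u]tens_clsK tens_smulE; congr tens_cls.
by rewrite -[RHS]map_id; apply: eq_map => -[x y] /=; rewrite scale1r.
Qed.

Lemma tens_smulDr : right_distributive tens_smul tens_add.
Proof.
move=> a u v; rewrite -[u]tens_clsK -[v]tens_clsK !(tens_addE, tens_smulE).
by rewrite /tens_scale_seq map_cat.
Qed.

Lemma tens_smulDl u a b :
  tens_smul (a + b) u = tens_add (tens_smul a u) (tens_smul b u).
Proof.
rewrite -[u]tens_clsK !tens_smulE tens_addE; apply/tens_clsP.
elim: (repr u) => [|[x y] s IH] /=; first exact: TensRefl.
rewrite scalerDl -cat1s.
apply: (TensTrans (TensCat (TensAddl (a *: x) (b *: x) y) IH)).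
rewrite /= -[(a *: x, y) :: _]cat1s -[X in tens_rel _ X]cat1s.
apply: TensCat; first exact: TensRefl.
rewrite -cat1s -[(b *: x, y) :: tens_scale_seq b s]cat1s.
by rewrite !catA; apply: TensCat; [exact: TensComm | exact: TensRefl].
Qed.

Lemma tens_addN : left_inverse tens_zero tens_opp tens_add.
Proof.
move=> u; rewrite -{2}[u]tens_smul1 /tens_opp -tens_smulDl addNr.
exact: tens_smul0.
Qed.

HB.instance Definition _ :=
  GRing.isZmodule.Build tensor tens_addA tens_addC tens_add0 tens_addN.
HB.instance Definition _ :=
  GRing.Zmodule_isLmodule.Build R tensor
    tens_smulA tens_smul1 tens_smulDr tens_smulDl.

Definition tens (x : M) (y : N) : tensor := tens_cls [:: (x, y)].

Lemma tens_cls_sum s : tens_cls s = \sum_(p <- s) tens p.1 p.2.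
Proof.
elim: s => [|[x y] s IH]; first by rewrite big_nil.
by rewrite big_cons -IH -cat1s -tens_addE.
Qed.

Lemma tensDl x x' y : tens (x + x') y = tens x y + tens x' y.
Proof.
apply: etrans (esym (tens_addE [:: (x, y)] [:: (x', y)])).
by apply/tens_clsP/TensAddl.
Qed.

Lemma tensDr x y y' : tens x (y + y') = tens x y + tens x y'.
Proof.
apply: etrans (esym (tens_addE [:: (x, y)] [:: (x, y')])).
by apply/tens_clsP/TensAddr.
Qed.

Lemma tensZl a x y : tens (a *: x) y = a *: tens x y.
Proof. by rewrite /tens -[RHS]/(tens_smul a _) tens_smulE. Qed.

Lemma tensZr a x y : tens x (a *: y) = a *: tens x y.
Proof. by rewrite -tensZl; apply/esym/tens_clsP/TensScale. Qed.

Definition is_bilinear {L : lmodType R} (b : M -> N -> L) :=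
  (forall y, linear (b^~ y)) /\ (forall x, linear (b x)).

Section Lift.
Variables (L : lmodType R) (b : M -> N -> L) (bP : is_bilinear b).

Definition tens_lift (u : tensor) : L := \sum_(p <- repr u) b p.1 p.2.

Lemma tens_lift_rel s t : tens_rel s t ->
  \sum_(p <- s) b p.1 p.2 = \sum_(p <- t) b p.1 p.2.
Proof.
have bl x x' y a : b (a *: x + x') y = a *: b x y + b x' y by apply: bP.1.
have br x y y' a : b x (a *: y + y') = a *: b x y + b x y' by apply: bP.2.
have b0 y : b 0 y = 0.
  by have := bl 0 0 y (-1); rewrite scaler0 addr0 scaleN1r addNr.
have c0 x : b x 0 = 0.
  by have := br x 0 0 (-1); rewrite scaler0 addr0 scaleN1r addNr.
elim=> {s t} [s|s t _|s t u _ st _|s s' t t' _ IH1 _ IH2|s t|y|x x' y|x y y'|a x y] //.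
- by rewrite st.
- by rewrite !big_cat IH1 IH2.
- by rewrite !big_cat /= addrC.
- by rewrite big_seq1 big_nil b0.
- by rewrite !big_cons !big_nil /= !addr0 -[x in LHS]scale1r bl scale1r.
- by rewrite !big_cons !big_nil /= !addr0 -[y in LHS]scale1r br scale1r.
- by rewrite !big_seq1 /= -[a *: x]addr0 bl b0 -[a *: y]addr0 br c0.
Qed.

Lemma tens_liftE s : tens_lift (tens_cls s) = \sum_(p <- s) b p.1 p.2.
Proof. exact/tens_lift_rel/tens_rel_repr. Qed.

Lemma tens_lift_tens x y : tens_lift (tens x y) = b x y.
Proof. by rewrite tens_liftE big_seq1. Qed.

Lemma tens_lift_linear : linear tens_lift.
Proof.
move=> a u v; rewrite -[u]tens_clsK -[v]tens_clsK.
rewrite -[a *: _]/(tens_smul a _) -[_ + _ in LHS]/(tens_add _ _).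
rewrite tens_smulE tens_addE !tens_liftE big_cat big_map scaler_sumr.
congr (_ + _); apply: eq_bigr => -[x y] _ /=.
have b0 : b 0 y = 0.
  by have := bP.1 y (-1) 0 0; rewrite /= scaler0 addr0 scaleN1r addNr.
by have := bP.1 y a x 0; rewrite /= !addr0 b0 addr0.
Qed.

End Lift.
End Tensor.

Section TensorMap.
Variables (R : comNzRingType) (T M N : lmodType R) (f : {linear M -> N}).

Let b (t : T) (x : M) : tensor T N := tens t (f x).

Lemma tens_map_bilinear : is_bilinear b.
Proof.
split=> [x a t t'|t a x x']; rewrite /b /=; first by rewrite tensDl tensZl.
by rewrite linearP tensDr tensZr.
Qed.

(* [T (x) f], characterized by [t (x) x |-> t (x) f x]. *)
Definition tens_map : tensor T M -> tensor T N := tens_lift b.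

Lemma tens_map_linear : linear tens_map.
Proof. exact: tens_lift_linear tens_map_bilinear. Qed.

HB.instance Definition _ :=
  GRing.isLinear.Build R (tensor T M) (tensor T N) _ tens_map tens_map_linear.

Lemma tens_mapE t x : tens_map (tens t x) = tens t (f x).
Proof. exact: tens_lift_tens tens_map_bilinear t x. Qed.

End TensorMap.

Section Tor.
Variable R : comNzRingType.

(* .. -> P 2 -> P 1 -> P 0 -> N -> 0, where [pr_d i : P i.+1 -> P i]. *)
Record proj_resolution (N : lmodType R) := ProjResolution {
  pr_mod :> nat -> lmodType R;
  pr_d : forall i, {linear pr_mod i.+1 -> pr_mod i};
  pr_aug : {linear pr_mod 0%N -> N};
  pr_projective : forall i, projective (pr_mod i);
  pr_aug_surj : forall y, exists x, pr_aug x = y;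
  pr_aug_exact : forall x, pr_aug x = 0 <-> exists z, x = pr_d 0%N z;
  pr_d_exact : forall i x, pr_d i x = 0 <-> exists z, x = pr_d i.+1 z }.

Definition tens_cycle (T N : lmodType R) (P : proj_resolution N) (i : nat) :
    set (tensor T (P i)) :=
  match i return set (tensor T (P i)) with
  | 0 => setT
  | j.+1 => [set u | tens_map (pr_d P j) u = 0]
  end.

Definition tens_boundary (T N : lmodType R) (P : proj_resolution N) (i : nat) :
    set (tensor T (P i)) :=
  [set u | exists w, u = tens_map (pr_d P i) w].

Arguments tens_cycle T {N} P i _.
Arguments tens_boundary T {N} P i _.

(* Tor_i(T, N) = H_i(T (x) P) is, up to isomorphism, independent of the
   projective resolution [P] of [N]. *)
Definition Tor_eq0 (i : nat) (T N : lmodType R) :=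
  forall P : proj_resolution N, tens_cycle T P i `<=` tens_boundary T P i.

Definition proj_test (T : lmodType R) :=
  forall N : lmodType R, fin_gen N ->
    (forall i, (0 < i)%N -> Tor_eq0 i T N) <-> projective N.

End Tor.

(* Main.v *)
Require Import Defs.
From HB Require Import structures.
From mathcomp Require Import all_boot all_algebra.
From mathcomp Require Import boolp classical_sets.

Set Implicit Arguments.
Unset Strict Implicit.
Unset Printing Implicit Defensive.

Import GRing.Theory.
Local Open Scope ring_scope.

(* Let .. -> R^(b 1) -> R^(b 0) -> N be the minimal free resolution of [N], with
   matrices [D i] acting on row vectors, and let [tau <> 0] lie in the socle of
   [T].  Then [tau (x) e_l] is a cycle in each positive degree, hence a boundary.
   A column [c] with [D i c] in [m^2] ([i > 0]) defines a functional
   [t (x) v |-> (v c) t] which kills the boundaries because [m^2 T = 0]; so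
   [c_l tau = 0] for all [l], and [c] has entries in [m].

   Write [D i = sum_j x_j A_(i,j)] modulo [m^2], for a minimal generating family
   [x_1, .., x_n] of [m].  As [v(R) >= 3], the monomials [x_j x_l], [j <= l], are
   independent modulo [m^3], so [D (i+1) D i = 0] makes the [A_j] anticommute and
   square to 0 modulo [m].  A product of [n+1] of them therefore vanishes modulo
   [m].  If [A_j c] has entries in [m] for all [j], then [D c] is in [m^2] and
   [c] is in [m]; peeling off the [n+1] factors this way shows that every column
   of [R^(b 1)] has entries in [m], i.e. [b 1 = 0] and [N] is free. *)

(** * Local rings *)

Section FamilyConcatenation.
Variables (S : Type) (p q : nat) (a : 'I_p -> S) (b : 'I_q -> S).

Definition fcat (i : 'I_(p + q)) : S :=
  match split i with inl j => a j | inr j => b j end.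

Lemma fcatl j : fcat (lshift q j) = a j.
Proof. by rewrite /fcat (unsplitK (inl j)). Qed.

Lemma fcatr j : fcat (rshift p j) = b j.
Proof. by rewrite /fcat (unsplitK (inr j)). Qed.

Lemma fcat_all (P : S -> Prop) :
  (forall j, P (a j)) -> (forall j, P (b j)) -> forall i, P (fcat i).
Proof. by rewrite /fcat => Pa Pb i; case: split. Qed.

End FamilyConcatenation.

Section Ideals.
Variable R : comNzRingType.
Implicit Types I J m : set R.

Lemma is_ideal0 I : is_ideal I -> I 0. Proof. by case. Qed.

Lemma is_idealD I x y : is_ideal I -> I x -> I y -> I (x + y).
Proof. by case=> _ + _; apply. Qed.

Lemma is_idealMr I a x : is_ideal I -> I x -> I (a * x).
Proof. by case=> _ _; apply. Qed.

Lemma is_idealMl I a x : is_ideal I -> I x -> I (x * a).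
Proof. by rewrite mulrC; apply: is_idealMr. Qed.

Lemma is_idealN I x : is_ideal I -> I x -> I (- x).
Proof. by move=> II Ix; rewrite -mulN1r; apply: is_idealMr. Qed.

Lemma is_idealB I x y : is_ideal I -> I x -> I y -> I (x - y).
Proof. by move=> II Ix Iy; apply: is_idealD (is_idealN _ _). Qed.

Lemma is_ideal_sum I (K : Type) (r : seq K) (P : pred K) (F : K -> R) :
  is_ideal I -> (forall k, P k -> I (F k)) -> I (\sum_(k <- r | P k) F k).
Proof.
by move=> II IF; elim/big_rec: _ => [|k x /IF];
  [exact: is_ideal0|exact: is_idealD].
Qed.

Lemma ideal_mulP I J x y : I x -> J y -> ideal_mul I J (x * y).
Proof.
move=> Ix Jy; exists 1%N, (fun=> x), (fun=> y).
by split=> //; rewrite big_ord1.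
Qed.

Lemma ideal_mul_ind I J K : is_ideal K ->
  (forall x y, I x -> J y -> K (x * y)) ->
  forall z, ideal_mul I J z -> K z.
Proof.
move=> KK IJK _ [n [a [b [Ia Jb ->]]]].
by apply: is_ideal_sum => // k _; apply: IJK.
Qed.

Lemma ideal_mul_ideal I J : is_ideal I -> is_ideal (ideal_mul I J).
Proof.
move=> II; split.
- by exists 0%N, (fun=> 0), (fun=> 0); split=> [[]|[]|] //; rewrite big_ord0.
- move=> _ _ [n [a [b [Ia Jb ->]]]] [p [c [d [Ic Jd ->]]]].
  exists (n + p)%N, (fcat a c), (fcat b d).
  split; [exact: fcat_all|exact: fcat_all|].
  rewrite big_split_ord; congr (_ + _); apply: eq_bigr => i _.
    by rewrite !fcatl.
  by rewrite !fcatr.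
- move=> x _ [n [a [b [Ia Jb ->]]]]; exists n, (fun i => x * a i), b.
  split=> // [i|]; first exact: is_idealMr.
  by rewrite mulr_sumr; apply: eq_bigr => i _; rewrite mulrA.
Qed.

Lemma ideal_pow_ideal I n : is_ideal I -> is_ideal (ideal_pow I n).
Proof. by case: n => [|n] // II; exact: ideal_mul_ideal. Qed.

Lemma ideal_pow1 I : is_ideal I -> ideal_pow I 1 = I.
Proof.
move=> II; apply/seteqP; split=> [|x Ix].
  by move=> x; apply: ideal_mul_ind => // y z Iy _; apply: is_idealMl.
by rewrite -[x]mulr1; apply: ideal_mulP.
Qed.

Lemma ideal_pow2P I x y : is_ideal I -> I x -> I y -> ideal_pow I 2 (x * y).
Proof.
by move=> II Ix Iy; apply: ideal_mulP => //; rewrite -/(ideal_pow I 1) ideal_pow1.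
Qed.

End Ideals.

Section LocalRing.
Variables (R : comNzRingType) (m : set R).
Hypothesis R_local : local_ring m.

Lemma local_ideal : is_ideal m. Proof. by have [[]] := R_local. Qed.

Lemma local_neq1 : ~ m 1. Proof. by have [[]] := R_local. Qed.

(** Zorn's lemma yields [J] maximal among the subsets closed under sums and multiples for which
    [J + R x] avoids 1; then [J + R x] is a maximal ideal. *)
Lemma ideal_sub_maximal (x : R) : (forall u, u * x <> 1) ->
  exists J, maximal_ideal J /\ J x.
Proof.
move=> xN1.
(* Stated so as to hold of the empty set, which [Zorn_bigcup] requires as the
   union of the empty chain. *)
pose P (J : set R) := [/\ forall y z, J y -> J z -> J (y + z),
  forall a y, J y -> J (a * y) &
  forall a, a * x <> 1 /\ forall y, J y -> y + a * x <> 1].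
have [|J [PJ maxJ]] := @Zorn_bigcup R P.
  move=> F FP Ftot; split=> [y z [A FA Ay] [B FB Bz]|a y [A FA Ay]|a].
  - have [AB|BA] := Ftot _ _ FA FB.
      by exists B => //; have [+ _ _] := FP _ FB; apply=> //; apply: AB.
    by exists A => //; have [+ _ _] := FP _ FA; apply=> //; apply: BA.
  - by exists A => //; have [_ + _] := FP _ FA; apply.
  - split=> // y [A FA Ay].
    by have [_ _ /(_ a)[_]] := FP _ FA; apply.
(* [K] is [J + R x]; the multiples of [x] form a separate case because [J] might be empty. *)
pose K : set R := fun z =>
  exists a, z = a * x \/ exists2 y, J y & z = y + a * x.
have [JD JM JN1] := PJ.
have KK : is_ideal K.
  split; first by exists 0; left; rewrite mul0r.
    move=> _ _ [a [->|[y Jy ->]]] [b [->|[z Jz ->]]]; exists (a + b).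
    - by left; rewrite mulrDl.
    - by right; exists z; rewrite // mulrDl addrCA.
    - by right; exists y; rewrite // mulrDl addrA.
    - by right; exists (y + z); [exact: JD|rewrite mulrDl addrACA].
  move=> a _ [b [->|[y Jy ->]]]; exists (a * b); first by left; rewrite mulrA.
  by right; exists (a * y); [exact: JM|rewrite mulrDr mulrA].
have Kx : K x by exists 1; left; rewrite mul1r.
have K1 : ~ K 1.
  by case=> a [/esym|[y Jy /esym]]; have [N1 N2] := JN1 a;
    [exact: N1|exact: N2].
exists K; split=> //; split=> // L LL L1 KL; apply/seteqP; split=> //.
(* A proper ideal above [K] contains [x], so it satisfies [P]; maximality of [J] then puts it inside
   [J], hence inside [K]. *)
have PL : P L.
  split=> [y z|a y|a]; [exact: is_idealD|exact: is_idealMr|split=> [E|y Ly E]].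
    by apply: L1; rewrite -E; apply: is_idealMr => //; apply: KL.
  by apply: L1; rewrite -E; apply: is_idealD => //;
      apply: is_idealMr => //; apply: KL.
have JL : (J `<=` L)%classic.
  by move=> y Jy; apply: KL; exists 0; right; exists y; rewrite // mul0r addr0.
apply: contrapT => LK; apply: (maxJ L) => //; split=> // LJ; apply: LK => y Ly.
by exists 0; right; exists y; [exact: LJ|rewrite mul0r addr0].
Qed.

Lemma local_unit x : ~ m x -> exists u, u * x = 1.
Proof.
move=> mx; apply: contrapT => /forallNP xN1.
have [J [maxJ Jx]] := ideal_sub_maximal xN1.
by apply: mx; rewrite -(R_local.2 _ maxJ).
Qed.

Lemma local_nunit x : m (x - 1) -> ~ m x.
Proof.
move=> mx1 mx; apply: local_neq1.
rewrite -[1](subKr x); apply: is_idealB => //; exact: local_ideal.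
Qed.

End LocalRing.

(** * Submodules and minimal generating families *)

Section Submodules.
Variables (R : comNzRingType) (M : lmodType R).
Implicit Types A B : set M.

Definition is_submod A :=
  [/\ A 0, forall x y, A x -> A y -> A (x + y) & forall a x, A x -> A (a *: x)].

Definition gen_mod A B n (x : 'I_n -> M) :=
  (forall i, A (x i)) /\
  forall y, A y -> exists c : 'I_n -> R, B (y - \sum_i c i *: x i).

(** For [m A] inside [B] this is independence over the residue field in [A / B]; for [B = 0] it is
    minimality of a generating family. *)
Definition rel_free (m : set R) B n (x : 'I_n -> M) :=
  forall c : 'I_n -> R, B (\sum_i c i *: x i) -> forall i, m (c i).

(** A generating family of least length works: a relation with a coefficient outside [m], hence a
    unit, would allow one generator to be dropped. *)
Lemma minimal_generators (m : set R) A B : local_ring m -> is_submod B ->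
  (exists n (x : 'I_n -> M), gen_mod A B x) ->
  exists n (x : 'I_n -> M), gen_mod A B x /\ rel_free m B x.
Proof.
move=> R_local [B0 BD BZ] [n0 [x0 x0P]].
pose P n := `[< exists x : 'I_n -> M, gen_mod A B x >].
have exP : exists n, P n by exists n0; apply/asboolP; exists x0.
case: (ex_minnP exP) => n /asboolP[x [Ax xP]] min_n.
exists n, x; split=> //.
case: n => [|n] in x Ax xP min_n * => c Bc i; first by case: i.
apply: contrapT => mci; have [u uc] := local_unit R_local mci.
suff : P n by move=> /min_n; rewrite ltnn.
apply/asboolP; exists (fun j => x (lift i j)); split=> // y /xP[d Bd].
(* Modulo [B], [x i] is [- u] times the sum of the other terms [c j *: x j]; this is substituted
   into the expression of [y]. *)
exists (fun j => d (lift i j) - d i * u * c (lift i j)).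
suff -> : y - \sum_j (d (lift i j) - d i * u * c (lift i j)) *: x (lift i j)
  = (y - \sum_j d j *: x j) + (d i * u) *: \sum_j c j *: x j.
  by apply: BD => //; apply: BZ.
rewrite !(bigD1_ord i) //= scalerDr scalerA -mulrA uc mulr1 scaler_sumr.
rewrite -addrA; congr (_ + _); rewrite opprD addrACA addNr add0r.
rewrite -!sumrN -big_split /=; apply: eq_bigr => j _.
by rewrite scalerBl opprB scalerA addrC.
Qed.


End Submodules.

(** Induction on the number of columns: the first coordinates of [A] form a finitely generated ideal
    [I], and the rows of [A] with first coordinate 0 form a submodule in one column less. *)
Lemma noetherian_row (R : comNzRingType) c (A : set 'rV[R]_c) :
  noetherian R -> is_submod A ->
  exists n (x : 'I_n -> 'rV_c), gen_mod A [set 0] x.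
Proof.
move=> noethR; elim: c A => [|c IHc] A [A0 AD AZ].
  exists 0%N, (fun=> 0); split=> [[]//|y _]; exists (fun=> 0).
  by apply/rowP; case.
pose I : set R := fun a => exists2 v, A v & v 0 0 = a.
have II : is_ideal I.
  split; first by exists 0; rewrite ?mxE.
    move=> _ _ [v Av <-] [w Aw <-].
    by exists (v + w); [exact: AD|rewrite mxE].
  by move=> a _ [v Av <-]; exists (a *: v); [exact: AZ|rewrite mxE].
have [p [a aE]] := noethR _ II.
have aI i : I (a i).
  rewrite aE; exists (fun j => (j == i)%:R).
  rewrite (bigD1 i) //= eqxx mul1r big1 ?addr0 // => j /negPf->.
  by rewrite mul0r.
have /choice[v vP] i : exists w, A w /\ w 0 0 = a i.
  by have [w] := aI i; exists w.
pose A' : set 'rV_c := fun w => A (row_mx (0 : 'rV_1) w).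
have [|q [w [Aw wP]]] := IHc A'.
  split; first by rewrite /A' row_mx0.
    move=> x y Ax Ay; rewrite /A' -[0]addr0 -add_row_mx; exact: AD.
  by move=> b x Ax; rewrite /A' -(scaler0 _ b) -scale_row_mx; apply: AZ.
exists (p + q)%N, (fcat v (fun j => row_mx (0 : 'rV_1) (w j))).
split=> [|y Ay]; first by apply: fcat_all => [j|]; [case: (vP j)|exact: Aw].
have : I (y 0 0) by exists y.
rewrite aE => -[d yd].
(* Subtracting the lifts [v i] of the generators of [I] kills the first coordinate of [y]. *)
pose z : 'rV_(1 + c) := y - \sum_i d i *: v i.
have Az : A z.
  rewrite /z -scaleN1r; apply: (AD) => //; apply: (AZ).
  by apply: (big_ind A) => // i _; apply: AZ; case: (vP i).
have z0 : lsubmx z = 0.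
  apply/rowP => i; rewrite !mxE summxE !ord1.
  rewrite (_ : lshift c 0 = 0); last exact: val_inj.
  rewrite yd; apply/eqP; rewrite subr_eq0; apply/eqP/eq_bigr => j _.
  by rewrite !mxE; case: (vP j) => _ ->.
have [|e /eqP] := wP (rsubmx z); first by rewrite /A' -z0 hsubmxK.
rewrite subr_eq0 => /eqP zE.
exists (fcat d e); rewrite /= big_split_ord /=.
rewrite (eq_bigr (fun j => d j *: v j)) => [|j _]; last by rewrite !fcatl.
rewrite [X in _ - (_ + X)](eq_bigr (fun j => e j *: row_mx (0 : 'rV_1) (w j)))
  => [|j _]; last by rewrite !fcatr.
rewrite opprD addrA -/z -[z]hsubmxK z0 zE.
apply/eqP; rewrite subr_eq0; apply/eqP.
rewrite (big_morph (row_mx (0 : 'rV_1)) (id1 := 0) (op1 := +%R)).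
- by apply: eq_bigr => j _; rewrite scale_row_mx scaler0.
- by move=> s t; rewrite add_row_mx addr0.
- exact: row_mx0.
Qed.

(** * Residue bases and the Hilbert function *)

Section Congruences.
Variables (R : comNzRingType) (I : set R).
Hypothesis II : is_ideal I.

Lemma prod_cong (K : finType) (F G : K -> R) :
  (forall k, I (F k - G k)) -> I (\prod_k F k - \prod_k G k).
Proof.
move=> FG; apply: (big_ind2 (fun a b => I (a - b))) => [|a b c d ab cd|k _];
  last exact: FG.
  by rewrite subrr; apply: is_ideal0.
rewrite (_ : _ - _ = (a - b) * c + b * (c - d)).
  by apply: is_idealD => //; [apply: is_idealMl|apply: is_idealMr].
by rewrite mulrBl mulrBr addrA subrK.
Qed.

Lemma det_cong n (M N : 'M[R]_n) :
  (forall i j, I (M i j - N i j)) -> I (\det M - \det N).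
Proof.
move=> MN; rewrite /determinant -sumrB; apply: is_ideal_sum => // s _.
by rewrite -mulrBr; apply: is_idealMr => //; apply: prod_cong.
Qed.

End Congruences.

Lemma card_le_pairs n :
  #|[pred p : 'I_n * 'I_n | (p.1 <= p.2)%N]| = 'C(n.+1, 2).
Proof.
transitivity (\sum_(i < n) \sum_(j < n | (i <= j)%N) 1)%N.
  by rewrite pair_big_dep sum1_card.
rewrite (exchange_big_dep xpredT) //= -bin2_sum big_nat_recl // big_mkord.
apply: eq_bigr => j _.
by rewrite -(big_ord_widen n (fun=> 1%N) (ltn_ord j)) sum1_card card_ord.
Qed.

Section ResidueBases.
Variables (R : comNzRingType) (m : set R).
Hypothesis R_local : local_ring m.

(** Let [P] express [a] by [y] and [Q] express [y] by [a]. Then [P Q] is the identity modulo [m], so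
    its determinant is a unit and [s = d]; thus [Q] is invertible, and it turns a relation among the
    [y] into one among the [a]. *)
Lemma generators_residue_free (A B : set R) d (a : 'I_d -> R) s (y : 'I_s -> R) :
  is_ideal B -> residue_basis m A B a -> gen_mod (M := R^o) A B y ->
  (s <= d)%N -> rel_free (M := R^o) m B y.
Proof.
move=> BI [Aa aP a_free] [Ay yP] s_le_d.
have mI := local_ideal R_local.
have /choice[P PE] i : exists c : 'I_s -> R, B (a i - \sum_j c j * y j).
  exact: (yP _ (Aa i)).
have /choice[Q QE] j : exists c : 'I_d -> R, B (y j - \sum_i c i * a i).
  exact: (aP _ (Ay j)).
pose MP : 'M_(d, s) := \matrix_(i, j) P i j.
pose MQ : 'M_(s, d) := \matrix_(j, i) Q j i.
have subst (c : 'I_s -> R) :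
    B (\sum_j c j * y j - \sum_i (\sum_j c j * Q j i) * a i).
  under [X in _ - X]eq_bigr do rewrite mulr_suml.
  rewrite exchange_big -sumrB; apply: is_ideal_sum => // j _ /=.
  under eq_bigr do rewrite -mulrA.
  by rewrite -mulr_sumr -mulrBr; apply: is_idealMr.
have PQ1 i l : m ((MP *m MQ) i l - 1%:M i l).
  rewrite -opprB; apply: is_idealN => //.
  have -> : 1%:M i l - (MP *m MQ) i l = (i == l)%:R - \sum_j P i j * Q j l.
    by rewrite !mxE; congr (_ - _); apply: eq_bigr => j _; rewrite !mxE.
  (* This is the relation obtained by writing [a i] through the [y] and back through the [a]. *)
  apply: (a_free (fun l => (i == l)%:R - \sum_j P i j * Q j l)).
  under eq_bigr do rewrite mulrBl.
  rewrite sumrB (bigD1 i) //= eqxx mul1r [X in _ + X - _]big1 ?addr0; last first.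
    by move=> j /negPf ij; rewrite eq_sym ij mul0r.
  rewrite -(subrK (\sum_j P i j * y j) (a i)) -addrA.
  by apply: is_idealD.
have [u uE] : exists u, u * \det (MP *m MQ) = 1.
  apply: (local_unit R_local); apply: (local_nunit R_local).
  by rewrite -(det1 R d); apply: det_cong.
have PQ'1 : MP *m (MQ *m (u *: \adj (MP *m MQ))) = 1%:M.
  by rewrite mulmxA -scalemxAr mul_mx_adj scale_scalar_mx uE.
have sd : s = d by apply/eqP; rewrite eqn_leq s_le_d (mulmx1_min PQ'1).
subst s.
have Q'P1 := mulmx1C PQ'1.
move=> c Bc j.
pose w : 'rV_d := \row_j c j.
have wQ i : m ((w *m MQ) 0 i).
  have -> : (w *m MQ) 0 i = \sum_j c j * Q j i.
    by rewrite !mxE; apply: eq_bigr => k _; rewrite !mxE.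
  apply: (a_free (fun i => \sum_j c j * Q j i)).
  rewrite -[X in B X](subKr (\sum_j c j * y j)).
  by apply: is_idealB.
have -> : c j = w 0 j by rewrite mxE.
have -> : w = (w *m MQ) *m ((u *: \adj (MP *m MQ)) *m MP).
  by rewrite -mulmxA [MQ *m _]mulmxA Q'P1 mulmx1.
rewrite mxE.
by apply: is_ideal_sum => // k _; apply: is_idealMl.
Qed.

(** [embdim] is chosen by [xget], so it suffices that some finite basis exists; one comes from
    shortening a finite generating family of [m]. *)
Lemma embdim_residue_basis : noetherian R ->
  exists x : 'I_(embdim m) -> R, residue_basis m m (ideal_pow m 2) x.
Proof.
move=> noethR; have mI := local_ideal R_local.
apply: (@xgetPex _ 0%N [set d | exists a : 'I_d -> R,
                          residue_basis m m (ideal_pow m 2) a]).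
have [n [x [[xm xP] x_free]]] :
    exists n (x : 'I_n -> R), gen_mod (M := R^o) m (ideal_pow m 2) x /\
      rel_free (M := R^o) m (ideal_pow m 2) x.
  apply: (@minimal_generators R R^o) => //; first exact: ideal_pow_ideal.
  have [n [a mE]] := noethR m mI; exists n, a; split=> [i|y].
    rewrite mE; exists (fun j => (j == i)%:R).
    rewrite (bigD1 i) //= eqxx mul1r big1 ?addr0 // => j /negPf->.
    by rewrite mul0r.
  rewrite {1}mE => -[c ->]; exists c; rewrite subrr.
  exact: (is_ideal0 (ideal_pow_ideal 2 mI)).
by exists n, x.
Qed.

(** The index 2 lies below the infimum, so the strict inequality defining [v_inv] fails there. *)
Lemma v_inv_hilbert2 : le_nat_inf 3 (v_inv m) ->
  ('C((embdim m).+1, 2) <= hilbert m 2)%N.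
Proof.
rewrite /v_inv /inf_nat leqNgt => v3; apply/negP => h2.
have P2 : `[< [set i | (hilbert m i < 'C((embdim m + i).-1, i))%N]%classic 2 >].
  by apply/asboolP; rewrite /= addn2.
case: pselect v3 => [exP|[]] /=; last by exists 2.
by case: ex_minnP => i _ /(_ 2 P2) i2; rewrite leqNgt ltnS i2.
Qed.

End ResidueBases.

(** * Independence of the quadratic monomials modulo m^3 *)

Section QuadraticMonomials.
Variables (R : comNzRingType) (m : set R).
Hypotheses (R_local : local_ring m) (v_ge3 : le_nat_inf 3 (v_inv m)).
Variable x : 'I_(embdim m) -> R.
Hypothesis x_basis : residue_basis m m (ideal_pow m 2) x.

Let n := embdim m.
Let D := [pred p : 'I_n * 'I_n | (p.1 <= p.2)%N].
Let y (i : 'I_#|D|) := x (enum_val i).1 * x (enum_val i).2.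

Lemma quadratic_monomials_generate :
  gen_mod (M := R^o) (ideal_pow m 2) (ideal_pow m 3) y.
Proof.
have [xm xP _] := x_basis; have mI := local_ideal R_local.
have m3I : is_ideal (ideal_pow m 3) by exact: ideal_pow_ideal.
split=> [i|]; first by apply: ideal_pow2P.
(* [K] is [m^3] plus the span of the monomials; being an ideal, it contains [m^2] once it contains
   the products of two elements of [m]. *)
pose K : set R := fun z =>
  exists c : 'I_#|D| -> R, ideal_pow m 3 (z - \sum_i c i * y i).
have KI : is_ideal K.
  split.
  - exists (fun=> 0); rewrite big1 ?subr0; first exact: is_ideal0.
    by move=> i _; rewrite mul0r.
  - move=> z t [c zc] [d td]; exists (fun i => c i + d i).
    under eq_bigr do rewrite mulrDl.
    by rewrite big_split opprD addrACA; apply: is_idealD.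
  - move=> a z [c zc]; exists (fun i => a * c i).
    under eq_bigr do rewrite -mulrA.
    by rewrite -mulr_sumr -mulrBr; apply: is_idealMr.
have m3K z : ideal_pow m 3 z -> K z.
  move=> zm; exists (fun=> 0); rewrite big1 ?subr0 // => i _.
  by rewrite mul0r.
have xxK j l : K (x j * x l).
  wlog jl : j l / (j <= l)%N.
    by move=> H; have /orP[/H //|/H] := leq_total j l; rewrite mulrC.
  have Djl : (j, l) \in D by [].
  exists (fun i => (i == enum_rank_in Djl (j, l))%:R).
  rewrite (bigD1 (enum_rank_in Djl (j, l))) //= eqxx mul1r big1 ?addr0.
    by rewrite /y enum_rankK_in // subrr; apply: is_ideal0.
  by move=> i /negPf ->; rewrite mul0r.
move=> z; suff : ideal_pow m 2 z -> K z by [].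
apply: ideal_mul_ind => // a b am; rewrite -/(ideal_pow m 1).
rewrite ideal_pow1 // => bm.
have [c ac] := xP _ am; have [d bd] := xP _ bm.
(* Replacing [a], then [b], by a linear form in the [x j] costs a product of an element of [m] and
   one of [m^2]. *)
rewrite -(subrK (\sum_j c j * x j) a) mulrDl mulr_suml.
apply: is_idealD => //; first by apply: m3K; rewrite mulrC; apply: ideal_mulP.
apply: is_ideal_sum => // j _; rewrite -mulrA; apply: is_idealMr => //.
rewrite -(subrK (\sum_j d j * x j) b) mulrDr mulr_sumr.
apply: is_idealD => //; first by apply: m3K; apply: ideal_mulP.
by apply: is_ideal_sum => // l _; rewrite mulrCA; apply: is_idealMr.
Qed.

(** The monomials generate [m^2] modulo [m^3] and, as [v(R) >= 3], there are at most [hilbert m 2]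
    of them, so they are independent. *)
Lemma quadratic_monomials_free (e : 'I_n -> 'I_n -> R) :
  ideal_pow m 3 (\sum_j \sum_l e j l * (x j * x l)) ->
  (forall j, m (e j j)) /\ (forall j l, j != l -> m (e j l + e l j)).
Proof.
have mI := local_ideal R_local.
move=> em3.
pose c (p : 'I_n * 'I_n) :=
  if p.1 == p.2 then e p.1 p.2 else e p.1 p.2 + e p.2 p.1.
suff c_in_m p : p \in D -> m (c p).
  split=> [j|j l jl].
    by have := c_in_m (j, j); rewrite inE /= leqnn /c /= eqxx; apply.
  wlog jl' : j l jl / (j <= l)%N.
    move=> H; have /orP[/H|/H] := leq_total j l; first exact.
    by rewrite addrC; apply; rewrite eq_sym.
  by have := c_in_m (j, l); rewrite inE /= /c /= (negPf jl); apply.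
move=> Dp.
have sumE : \sum_j \sum_l e j l * (x j * x l)
    = \sum_(i < #|D|) c (enum_val i) * y i.
  rewrite -(big_enum_val (fun p => c p * (x p.1 * x p.2))) /=.
  (* The pairs with [j > l] are swapped and collected with those with [j < l]. *)
  rewrite pair_bigA (bigID [in D]) /=.
  rewrite [X in _ + X](reindex_inj (can_inj swap_pairK)) /=.
  rewrite [X in _ + X](eq_bigl (fun p => (p \in D) && (p.1 != p.2)));
    last by move=> [j l]; rewrite !inE /= -ltnNge ltn_neqAle andbC.
  rewrite big_mkcondr -big_split; apply: eq_bigr => -[j l] _ /=.
  rewrite /c /=; case: eqP => _; first by rewrite addr0.
  by rewrite -(mulrC (x j)) mulrDl.
rewrite sumE in em3.
have m3I : is_ideal (ideal_pow m 3) by exact: ideal_pow_ideal.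
suff : exists d (a : 'I_d -> R),
    residue_basis m (ideal_pow m 2) (ideal_pow m 3) a /\ (#|D| <= d)%N.
  move=> [d [a [a_basis le_d]]].
  have := generators_residue_free R_local m3I a_basis
            quadratic_monomials_generate le_d em3 (enum_rank_in Dp p).
  by rewrite enum_rankK_in.
have := v_inv_hilbert2 v_ge3; rewrite card_le_pairs -/n.
rewrite /hilbert /residue_dim; case: xgetP => [d _ [a a_basis] le_d|_].
  by exists d, a.
(* Without a basis, [hilbert m 2] is the default 0, too small because the pair [p] forces
   [n > 0]. *)
rewrite leqNgt bin_gt0 ltnS => /negP[].
by case: (p) => j _; apply: leq_ltn_trans (ltn_ord j).
Qed.

End QuadraticMonomials.

(** * Vanishing of Tor for projective modules *)

Section LinearRange.
Variables (R : comNzRingType) (A B : lmodType R) (g : {linear A -> B}).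

Definition lin_range : {pred B} := fun y => `[< exists a, g a = y >].

Fact lin_range_submod_closed : submod_closed lin_range.
Proof.
split=> [|a _ _ /asboolP[x <-] /asboolP[y <-]]; apply/asboolP.
  by exists 0; rewrite linear0.
by exists (a *: x + y); rewrite linearP.
Qed.

HB.instance Definition _ :=
  GRing.isSubmodClosed.Build R B lin_range lin_range_submod_closed.

Record range_sub := RangeSub { range_val :> B; _ : range_val \in lin_range }.
HB.instance Definition _ := [isSub for range_val].
HB.instance Definition _ := [Choice of range_sub by <:].
HB.instance Definition _ := [SubChoice_isSubLmodule of range_sub by <:].

(** [projective] lifts through surjections only, so [g] and [f] are corestricted to the range of
    [g]. *)
Lemma projective_lift_range (P : lmodType R) (f : {linear P -> B}) :
  projective P -> (forall x, exists a, g a = f x) ->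
  exists h : {linear P -> A}, forall x, g (h x) = f x.
Proof.
move=> projP fg.
have gP a : g a \in lin_range by apply/asboolP; exists a.
have fP x : f x \in lin_range by apply/asboolP.
pose g' a : range_sub := RangeSub (gP a).
pose f' x : range_sub := RangeSub (fP x).
have g'_lin : linear g' by move=> a x y; apply/val_inj; rewrite /= linearP.
have f'_lin : linear f' by move=> a x y; apply/val_inj; rewrite /= linearP.
pose gL : {linear A -> range_sub} :=
  HB.pack g' (GRing.isLinear.Build R A range_sub _ g' g'_lin).
pose fL : {linear P -> range_sub} :=
  HB.pack f' (GRing.isLinear.Build R P range_sub _ f' f'_lin).
have [|h hE] := projP _ _ gL fL.
  by case=> y yP; have /asboolP[a ay] := yP; exists a; apply/val_inj.
by exists h => x; have /(congr1 val) := hE x.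
Qed.

End LinearRange.

Section TensorMapTheory.
Variables (R : comNzRingType) (T : lmodType R).

Lemma tens_sum (M : lmodType R) (u : tensor T M) :
  u = \sum_(p <- repr u) tens p.1 p.2.
Proof. by rewrite -tens_cls_sum tens_clsK. Qed.

Lemma tens_map_sum (M N : lmodType R) (f : {linear M -> N}) (u : tensor T M) :
  tens_map f u = \sum_(p <- repr u) tens p.1 (f p.2).
Proof.
rewrite [in LHS](tens_sum u) linear_sum.
by apply: eq_bigr => p _; exact: tens_mapE.
Qed.

Lemma tens_map_comp (M N L : lmodType R) (f : {linear M -> N})
    (g : {linear N -> L}) (u : tensor T M) :
  tens_map g (tens_map f u) = \sum_(p <- repr u) tens p.1 (g (f p.2)).
Proof.
rewrite (tens_map_sum f) linear_sum.
by apply: eq_bigr => p _; exact: tens_mapE.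
Qed.

End TensorMapTheory.

Section ProjectiveTor.
Variables (R : comNzRingType) (N : lmodType R).
Hypothesis projN : projective N.
Variable P : proj_resolution N.

(** The augmentation splits, and inductively the identity minus [s' d] maps into the kernel of [d],
    which is the image of the next differential, and lifts through it. *)
Lemma projective_homotopy i :
  exists (s : {linear P i.+1 -> P i.+2}) (s' : {linear P i -> P i.+1}),
    forall x, x = pr_d P i.+1 (s x) + s' (pr_d P i x).
Proof.
have next j (s' : {linear P j -> P j.+1}) :
    (forall y, pr_d P j (s' (pr_d P j y)) = pr_d P j y) ->
    exists s : {linear P j.+1 -> P j.+2},
      forall x, x = pr_d P j.+1 (s x) + s' (pr_d P j x).
  move=> s'K; pose f : {linear P j.+1 -> P j.+1} := idfun \- (s' \o pr_d P j).
  have [x|s sE] := projective_lift_range (g := pr_d P j.+1) (f := f)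
                     (@pr_projective _ _ P j.+1).
    have /pr_d_exact[z xz] : pr_d P j (f x) = 0.
      by rewrite /f /= linearB /= s'K subrr.
    by exists z.
  by exists s => x; rewrite sE /f /= subrK.
(* Only [d s' d = d] is carried through the induction; [next] recovers the homotopy from it. *)
suff [s' s'K] : exists s' : {linear P i -> P i.+1},
    forall y, pr_d P i (s' (pr_d P i y)) = pr_d P i y.
  by have [s sE] := next _ _ s'K; exists s, s'.
elim: i => [|i [s' s'K]].
  have [t tK] := @projN _ _ (pr_aug P) idfun (@pr_aug_surj _ _ P).
  pose f : {linear P 0 -> P 0} := idfun \- (t \o pr_aug P).
  have [x|s sE] := projective_lift_range (g := pr_d P 0) (f := f)
                     (@pr_projective _ _ P 0).
    have /pr_aug_exact[z xz] : pr_aug P (f x) = 0.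
      by rewrite /f /= linearB /= tK subrr.
    by exists z.
  exists s => y; rewrite sE /f /=.
  by rewrite (proj2 (@pr_aug_exact _ _ P _) (ex_intro _ y erefl)) linear0 subr0.
have [s sE] := next _ _ s'K; exists s => y.
rewrite [RHS]sE [X in s' X](proj2 (@pr_d_exact _ _ P _ _) (ex_intro _ y erefl)).
by rewrite linear0 addr0.
Qed.

End ProjectiveTor.

(** Tensored with [T], the homotopy writes a cycle [u] as [d (s u) + s' (d u)], whose last term
    vanishes. *)
Lemma projective_Tor_eq0 (R : comNzRingType) (T N : lmodType R) i :
  projective N -> (0 < i)%N -> Tor_eq0 i T N.
Proof.
case: i => // i projN _ P u /= du0.
have [s [s' sE]] := projective_homotopy projN P i.
have -> : u = tens_map (pr_d P i.+1) (tens_map s u)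
              + tens_map s' (tens_map (pr_d P i) u).
  rewrite !tens_map_comp [LHS]tens_sum -big_split; apply: eq_bigr => p _ /=.
  by rewrite -tensDr -sE.
by exists (tens_map s u); rewrite du0 linear0 addr0.
Qed.

(** * Minimal free resolutions *)

Section FreeModules.
Variables (R : comNzRingType) (N : lmodType R) (b : nat).

Definition row_comb (x : 'I_b -> N) (u : 'rV[R]_b) : N := \sum_i u 0 i *: x i.

Lemma row_comb_linear x : linear (row_comb x).
Proof.
move=> a u v; rewrite /row_comb scaler_sumr -big_split; apply: eq_bigr => i _.
by rewrite !mxE scalerDl scalerA.
Qed.

HB.instance Definition _ x :=
  GRing.isLinear.Build R 'rV[R]_b N _ (row_comb x) (row_comb_linear x).

Lemma row_comb_linearE (f : {linear 'rV[R]_b -> N}) u :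
  f u = row_comb (fun i => f 'e_i) u.
Proof.
rewrite [in LHS](row_sum_delta u) linear_sum.
by apply: eq_bigr => i _; rewrite linearZ.
Qed.

End FreeModules.

Lemma row_projective (R : comNzRingType) b : projective 'rV[R]_b.
Proof.
move=> A B g f g_surj.
have /choice[a aE] i : exists a, g a = f 'e_i by apply: g_surj.
exists (row_comb a) => u; rewrite (row_comb_linearE f) /= /row_comb linear_sum.
by apply: eq_bigr => i _; rewrite linearZ /= aE.
Qed.

Lemma projective_iso (R : comNzRingType) (P N : lmodType R) (f : {linear P -> N}) :
  projective P -> (forall y, exists x, f x = y) -> (forall x, f x = 0 -> x = 0) ->
  projective N.
Proof.
move=> projP /choice[k fK] f_inj A B g h g_surj.
have kf x : k (f x) = x.
  by apply/eqP; rewrite -subr_eq0; apply/eqP/f_inj; rewrite linearB fK subrr.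
have k_lin : linear k.
  by move=> a y z; rewrite -{1}(fK y) -{1}(fK z) -linearP kf.
pose kL : {linear N -> P} := HB.pack k (GRing.isLinear.Build R N P _ k k_lin).
have [l lE] := projP A B g (h \o f) g_surj.
by exists (l \o kL) => y; rewrite /= lE /= fK.
Qed.

Section MinimalResolution.
Variables (R : comNzRingType) (m : set R).
Hypotheses (R_noetherian : noetherian R) (R_local : local_ring m).

(** The rows of the matrix are a minimal generating family of [A]. *)
Lemma submod_minimal_cover c (A : set 'rV[R]_c) : is_submod A ->
  exists s : {c' & 'M[R]_(c', c)},
    (forall u, A u <-> exists z, u = z *m projT2 s) /\
    forall z : 'rV_(projT1 s), z *m projT2 s = 0 -> forall i, m (z 0 i).
Proof.
move=> Asub.
have zero_sub : is_submod [set 0 : 'rV[R]_c].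
  by split=> [|x y -> ->|a x ->] //=; rewrite ?addr0 ?scaler0.
have [n [x [[Ax xP] x_free]]] :=
  minimal_generators R_local zero_sub (noetherian_row R_noetherian Asub).
exists (existT _ n (\matrix_i x i)) => /=.
have rowE (z : 'rV_n) : z *m (\matrix_i x i) = \sum_i z 0 i *: x i.
  by rewrite mulmx_sum_row; apply: eq_bigr => i _; rewrite rowK.
split=> [u|z]; last by rewrite rowE => /x_free.
split=> [/xP[c' /eqP]|[z ->]].
  rewrite subr_eq0 => /eqP ->; exists (\row_i c' i); rewrite rowE.
  by apply: eq_bigr => i _; rewrite mxE.
have [A0 AD AZ] := Asub; rewrite rowE; apply: (big_ind A) => // i _; exact: AZ.
Qed.

(** The sizes are bundled with the matrix so that covering the kernel is an endofunction, which
    [iter] can repeat. *)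
Record stage := Stage { src : nat; tgt : nat; mat : 'M[R]_(src, tgt) }.

Lemma kernel_submod c b (D : 'M[R]_(c, b)) : is_submod [set u : 'rV_c | u *m D = 0].
Proof.
split=> [|u v /= uD vD|a u /= uD]; first exact: mul0mx.
  by rewrite mulmxDl uD vD addr0.
by rewrite -scalemxAl uD scaler0.
Qed.

Definition next_stage (s : stage) : stage :=
  Stage (projT2 (sval (cid (submod_minimal_cover (kernel_submod (mat s)))))).

Lemma next_stageP s :
  (forall u : 'rV_(src s),
     u *m mat s = 0 <-> exists z, u = z *m mat (next_stage s)) /\
  forall z : 'rV_(src (next_stage s)),
    z *m mat (next_stage s) = 0 -> forall i, m (z 0 i).
Proof. by rewrite /next_stage; case: cid. Qed.

(** Minimal covers of [N] and of the successive kernels are spliced. The rows of each differential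
    are relations among minimal generators, hence have entries in [m]. *)
Lemma minimal_resolution (N : lmodType R) : fin_gen N ->
  exists (b : nat -> nat) (D : forall i, 'M[R]_(b i.+1, b i)) (x : 'I_(b 0) -> N),
    [/\ forall y, exists u, row_comb x u = y,
        forall u, row_comb x u = 0 <-> exists z, u = z *m D 0,
        forall i (u : 'rV_(b i.+1)), u *m D i = 0 <-> exists z, u = z *m D i.+1 &
        forall i p q, m (D i p q)].
Proof.
move=> [n0 [x0 x0P]].
have [||n [x [[_ xP] x_free]]] := @minimal_generators R N m setT [set 0] R_local.
- by split=> [|x y -> ->|a x ->] //=; rewrite ?addr0 ?scaler0.
- exists n0, x0; split=> // y _; have [c ->] := x0P y.
  by exists c; rewrite /= subrr.
have Ksub : is_submod [set u : 'rV_n | row_comb x u = 0].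
  split=> [|u v /= uE vE|a u /= uE]; first exact: linear0.
    by rewrite linearD /= uE vE addr0.
  by rewrite linearZ /= uE scaler0.
have [[b1 D0] /= [D0P D0min]] := submod_minimal_cover Ksub.
pose st i := iter i next_stage (Stage D0).
have stP i := (next_stageP (st i)).1.
have st_min i (z : 'rV_(src (st i))) : z *m mat (st i) = 0 -> forall p, m (z 0 p).
  by case: i z => [|i]; [exact: D0min|exact: (next_stageP (st i)).2].
(* [tgt (st i.+1)] is convertible to [src (st i)], so consecutive matrices compose. *)
exists (fun i => tgt (st i)), (fun i => mat (st i)), x; split=> //.
- move=> y; have [c /eqP] := xP y I; rewrite subr_eq0 => /eqP ->.
  by exists (\row_i c i); apply: eq_bigr => i _; rewrite mxE.
- case=> [|i] p q.
    have := x_free (row p D0 0); rewrite /= -/(row_comb x _).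
    move=> /(_ _ q); rewrite mxE; apply.
    by apply/D0P; exists 'e_p; rewrite rowE.
  have := st_min i (row p (mat (st i.+1))) _ q.
  by rewrite mxE; apply; apply/stP; exists 'e_p; rewrite rowE.
Qed.

End MinimalResolution.

Section FreeResolution.
Variables (R : comNzRingType) (N : lmodType R).
Variables (b : nat -> nat) (D : forall i, 'M[R]_(b i.+1, b i)) (x : 'I_(b 0) -> N).
Hypothesis x_surj : forall y, exists u, row_comb x u = y.
Hypothesis x_exact : forall u, row_comb x u = 0 <-> exists z, u = z *m D 0.
Hypothesis D_exact : forall i (u : 'rV_(b i.+1)),
  u *m D i = 0 <-> exists z, u = z *m D i.+1.

Definition row_resolution : proj_resolution N :=
  @ProjResolution R N (fun i => 'rV[R]_(b i)) (fun i => mulmxr (D i)) (row_comb x)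
    (fun i => @row_projective R (b i)) x_surj x_exact D_exact.

End FreeResolution.

(** * Columns forced into m by the vanishing of Tor *)

Section Socle.
Variables (R : comNzRingType) (m : set R) (R_local : local_ring m).
Variables (T : lmodType R).
Hypothesis m2T0 : forall (a : R) (t : T), ideal_pow m 2 a -> a *: t = 0.

(** If [m T = 0], any nonzero element will do; otherwise a nonzero [a *: s] with [a] in [m] does, as
    [m^2 T = 0]. *)
Lemma socle_neq0 : (exists t : T, t != 0) ->
  exists tau : T, tau != 0 /\ forall a, m a -> a *: tau = 0.
Proof.
move=> [t t0].
have [[a [s [am as0]]]|mT0] := pselect (exists a s, m a /\ a *: (s : T) != 0).
  exists (a *: s); split=> // c cm; rewrite scalerA; apply: m2T0.
  by apply: ideal_pow2P => //; apply: local_ideal.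
exists t; split=> // a am; apply: contrapT => /eqP at0.
by apply: mT0; exists a, t.
Qed.

Lemma tens_socle0 b (tau : T) (v : 'rV[R]_b) :
  (forall a, m a -> a *: tau = 0) -> (forall i, m (v 0 i)) -> tens tau v = 0.
Proof.
move=> mtau vm.
have t0 y : tens (0 : T) (y : 'rV[R]_b) = 0 by rewrite -(scale0r 0) tensZl scale0r.
rewrite (row_sum_delta v) (big_morph _ (tensDr tau) (id1 := 0)) => [|].
  by rewrite big1 // => i _; rewrite tensZr -tensZl mtau.
by rewrite -(scale0r 0) tensZr scale0r.
Qed.

Variables (b2 b1 b0 : nat) (D1 : 'M[R]_(b2, b1)) (D0 : 'M[R]_(b1, b0)).
Hypothesis D0m : forall p q, m (D0 p q).
Hypothesis T_exact : forall u : tensor T 'rV[R]_b1,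
  tens_map (mulmxr D0) u = 0 -> exists w, u = tens_map (mulmxr D1) w.

Lemma exact_col_in_m (c : 'cV[R]_b1) : (exists t : T, t != 0) ->
  (forall p, ideal_pow m 2 ((D1 *m c) p 0)) -> forall l, m (c l 0).
Proof.
move=> /socle_neq0[tau [tau0 mtau]] D1c l.
have mI := local_ideal R_local.
pose beta (t : T) (v : 'rV[R]_b1) : T := (v *m c) 0 0 *: t.
have betaP : is_bilinear beta.
  split=> [v a s t|t a v w]; rewrite /beta.
    by rewrite scalerDr !scalerA mulrC.
  by rewrite mulmxDl -scalemxAl !mxE scalerDl scalerA.
(* A cycle, because row [l] of [D0] has entries in [m], which kill [tau]. *)
have [|w wE] := T_exact (u := tens tau 'e_l).
  by rewrite tens_mapE; apply: tens_socle0 => // i; rewrite /= -rowE mxE.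
apply: contrapT => mcl; have [u uE] := local_unit R_local mcl.
move/eqP: tau0; apply.
rewrite -[tau]scale1r -uE -scalerA.
suff -> : c l 0 *: tau = 0 by rewrite scaler0.
have -> : c l 0 *: tau = tens_lift beta (tens tau 'e_l).
  by rewrite (tens_lift_tens betaP) /beta -rowE mxE.
rewrite wE tens_map_sum.
(* As the class of a list, the boundary can be evaluated termwise by the lift of [beta]; each term
   is scaled by [p.2 *m D1 *m c], which is in [m^2]. *)
have -> : \sum_(p <- repr w) tens p.1 (mulmxr D1 p.2)
  = tens_cls [seq (p.1, mulmxr D1 p.2) | p <- repr w].
  by rewrite tens_cls_sum big_map.
rewrite (tens_liftE betaP) big_map big1 // => p _; apply: m2T0.
have m2I : is_ideal (ideal_pow m 2) by exact: ideal_pow_ideal.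
have -> : (mulmxr D1 p.2 *m c) 0 0 = \sum_k p.2 0 k * (D1 *m c) k 0.
  by rewrite /= -mulmxA mxE.
by apply: is_ideal_sum => // k _; apply: is_idealMr.
Qed.

End Socle.

(** * The linear part of the resolution *)

Section LinearPart.
Variables (R : comNzRingType) (m : set R).
Hypotheses (R_local : local_ring m) (v_ge3 : le_nat_inf 3 (v_inv m)).
Variables (b : nat -> nat) (D : forall i, 'M[R]_(b i.+1, b i)).
Hypothesis Dm : forall i p q, m (D i p q).
Hypothesis DD0 : forall i, D i.+1 *m D i = 0.
Hypothesis D_col : forall i (c : 'cV_(b i.+1)),
  (forall p, ideal_pow m 2 ((D i.+1 *m c) p 0)) -> forall l, m (c l 0).

Let mI : is_ideal m := local_ideal R_local.
Let n := embdim m.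

Definition mx_in p q (M : 'M[R]_(p, q)) := forall i j, m (M i j).

Lemma mx_inMr p q r (M : 'M[R]_(p, q)) (L : 'M_(q, r)) : mx_in L -> mx_in (M *m L).
Proof.
by move=> Lm i j; rewrite mxE; apply: is_ideal_sum => // k _; apply: is_idealMr.
Qed.

Lemma mx_inMl p q r (M : 'M[R]_(p, q)) (L : 'M_(q, r)) : mx_in M -> mx_in (M *m L).
Proof.
by move=> Mm i j; rewrite mxE; apply: is_ideal_sum => // k _; apply: is_idealMl.
Qed.

Lemma mx_inB p q (M L : 'M[R]_(p, q)) : mx_in M -> mx_in L -> mx_in (M - L).
Proof. by move=> Mm Lm i j; rewrite !mxE; apply: is_idealB. Qed.

Variables (x : 'I_n -> R) (x_basis : residue_basis m m (ideal_pow m 2) x).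
(** The index is shifted to match [D_col], which starts at [D 1]. *)
Variable A : forall i, 'I_n -> 'M[R]_(b i.+2, b i.+1).
Hypothesis DE : forall i p q,
  ideal_pow m 2 (D i.+1 p q - \sum_j A i j p q * x j).

(** Modulo [m^3], each entry of [D i.+2 *m D i.+1 = 0] is a quadratic form in the [x j], with
    coefficients the entries of [A i.+1 j *m A i l]. *)
Lemma linear_part_anticomm i :
  (forall j, mx_in (A i.+1 j *m A i j)) /\
  (forall j l, j != l -> mx_in (A i.+1 j *m A i l + A i.+1 l *m A i j)).
Proof.
have [xm _ _] := x_basis.
suff H p q : (forall j, m ((A i.+1 j *m A i j) p q)) /\
    forall j l, j != l -> m ((A i.+1 j *m A i l + A i.+1 l *m A i j) p q).
  split=> [j p q|j l jl p q]; first exact: (H p q).1.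
  exact: (H p q).2.
have m3I : is_ideal (ideal_pow m 3) by exact: ideal_pow_ideal.
have [|H1 H2] := @quadratic_monomials_free R m R_local v_ge3 x x_basis
  (fun j l => (A i.+1 j *m A i l) p q).
  have -> : \sum_j \sum_l (A i.+1 j *m A i l) p q * (x j * x l)
    = \sum_k (\sum_j A i.+1 j p k * x j) * (\sum_l A i l k q * x l).
    under eq_bigr => j _ do under eq_bigr => l _ do rewrite mxE mulr_suml.
    under eq_bigr => j _ do rewrite exchange_big.
    rewrite exchange_big; apply: eq_bigr => k _ /=.
    rewrite mulr_suml; apply: eq_bigr => j _.
    by rewrite mulr_sumr; apply: eq_bigr => l _; rewrite mulrACA.
  have DDE : \sum_k D i.+2 p k * D i.+1 k q = 0.
    by have /matrixP/(_ p q) := DD0 i.+1; rewrite !mxE.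
  rewrite -[X in ideal_pow m 3 X]subr0 -[X in _ - X]DDE.
  rewrite -sumrB; apply: is_ideal_sum => // k _.
  rewrite -opprB; apply: is_idealN => //.
  set s := \sum_j _; set t := \sum_l _.
  have sm : m s by apply: is_ideal_sum => // j _; apply: is_idealMr.
  (* Both error terms are in [m] times [m^2]. *)
  rewrite (_ : _ - _ = D i.+1 k q * (D i.+2 p k - s) + s * (D i.+1 k q - t)).
    by apply: is_idealD => //; apply: ideal_mulP => //; exact: DE.
  by rewrite !mulrBr addrA [D i.+1 k q * s]mulrC subrK mulrC.
split=> [j|j l jl]; first exact: H1.
by rewrite mxE; apply: H2.
Qed.

(** Each factor climbs one step of the resolution, so its degree is the number of factors to its
    right. *)
Fixpoint linear_col (c : 'cV[R]_(b 1)) (js : seq 'I_n) : 'cV[R]_(b (size js).+1) :=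
  if js is j :: js' then A (size js') j *m linear_col c js' else c.

(** [A_j] moves rightwards by anticommutation until it meets its own occurrence, where the square
    vanishes modulo [m]. *)
Lemma linear_col_mem c j js :
  j \in js -> mx_in (A (size js) j *m linear_col c js).
Proof.
elim: js => // l js IH; rewrite inE /= mulmxA.
have [sq anti] := linear_part_anticomm (size js).
have [-> _|jl /= /IH jm] := eqVneq j l; first exact: mx_inMl.
rewrite -(addrK (A (size js).+1 l *m A (size js) j) (_ *m A _ l)) mulmxBl.
apply: mx_inB; first exact/mx_inMl/anti.
by rewrite -mulmxA; apply: mx_inMr.
Qed.

Lemma linear_col_nuniq c js : ~~ uniq js -> mx_in (linear_col c js).
Proof.
elim: js => //= j js IH; rewrite negb_and negbK => /orP[/linear_col_mem|/IH] //.
exact: mx_inMr.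
Qed.

(** Descending induction on the length, [k] counting the missing factors; the case of interest is
    [js = [::]]. *)
Lemma linear_col_in c k js : (size js + k = n.+1)%N -> mx_in (linear_col c js).
Proof.
have [xm _ _] := x_basis.
elim: k js => [|k IH] js.
  (* Pigeonhole: [n + 1] indices among [n] values. *)
  rewrite addn0 => js_n; apply: linear_col_nuniq.
  apply/negP => /card_uniqP js_card.
  by have := max_card [in js]; rewrite js_card js_n card_ord ltnn.
(* It remains to see that [D] sends the column into [m^2]. Its linear part gives [x l] times entries
   of the column of [l :: js], which are in [m] by induction. *)
move=> js_k i j; rewrite ord1; apply: D_col => p; rewrite mxE.
have m2I : is_ideal (ideal_pow m 2) by exact: ideal_pow_ideal.
under eq_bigr => k' _ do
  rewrite -(subrK (\sum_l A (size js) l p k' * x l) (D _ p k')) mulrDl.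
rewrite big_split; apply: is_idealD => //=.
  by apply: is_ideal_sum => // q _; apply: is_idealMl => //; exact: DE.
under eq_bigr => q _ do rewrite mulr_suml.
rewrite exchange_big; apply: is_ideal_sum => // l _ /=.
under eq_bigr => q _ do rewrite mulrAC.
rewrite -mulr_suml.
apply: ideal_pow2P => //.
have := IH (l :: js); rewrite /= addSnnS => /(_ js_k p 0); rewrite mxE; exact.
Qed.

End LinearPart.

Theorem theorem7p1 (R : comNzRingType) (m : set R)
    (R_noetherian : noetherian R) (R_local : local_ring m)
    (v_ge3 : le_nat_inf 3 (v_inv m))
    (T : lmodType R) (T_fg : fin_gen T)
    (T_neq0 : exists t : T, t != 0)
    (m2T0 : forall (a : R) (t : T), ideal_pow m 2 a -> a *: t = 0) :
  proj_test T.
Proof.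
move=> N N_fg; split=> [TorN|projN i]; last exact: projective_Tor_eq0.
have [b [D [x [x_surj x_exact D_exact Dm]]]] :=
  minimal_resolution R_noetherian R_local N_fg.
apply: (projective_iso (f := row_comb x)) => // [|u /x_exact[z ->]].
  exact: row_projective.
suff -> : z = 0 by rewrite mul0mx.
(* An index [l] of [R^(b 1)] is absurd: entry [l] of the all-ones column would put 1 in [m]. *)
apply/rowP => l; case: (local_neq1 R_local).
have DD0 i : D i.+1 *m D i = 0.
  apply/row_matrixP => p; rewrite row_mul row0; apply/D_exact.
  by exists 'e_p; rewrite rowE.
pose P := row_resolution x_surj x_exact D_exact.
have D_col i (c : 'cV_(b i.+1)) :
    (forall p, ideal_pow m 2 ((D i.+1 *m c) p 0)) -> forall p, m (c p 0).
  apply: (exact_col_in_m R_local m2T0 (Dm i) _ T_neq0) => w.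
  exact: (TorN i.+1 isT P w).
have [y y_basis] := embdim_residue_basis R_local R_noetherian.
have [_ yP _] := y_basis.
pose A i j := \matrix_(p, q) sval (cid (yP _ (Dm i.+1 p q))) j.
have DE i p q : ideal_pow m 2 (D i.+1 p q - \sum_j A i j p q * y j).
  under eq_bigr => j _ do rewrite mxE.
  exact: svalP (cid (yP _ (Dm i.+1 p q))).
have := @linear_col_in _ _ R_local v_ge3 _ _ Dm DD0 D_col _ y_basis _ DE
  (const_mx 1) _ [::] erefl l 0.
by rewrite mxE.
Qed.
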